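(* The semi-implicit scheme (S1)--(S2) recalled in the context has the following properties. (i) Suppose $(\rho^n,\boldsymbol u^n)\in L_{\mathcal M}(\Omega)\times\boldsymbol H_{\mathcal E,0}(\Omega)$ with $\rho^n>0$, and let $(\rho^{n+1},\boldsymbol u^{n+1})\in L_{\mathcal M}(\Omega)\times\boldsymbol H_{\mathcal E,0}(\Omega)$ solve the scheme. Then $\rho^{n+1}_K=\tilde\rho_K$ for all $K\in\mathcal M$ and $u^{n+1}_\sigma=0$ for all $\sigma\in\mathcal E^{(i)}$, $i=1,\dots,d$, if and only if $$\frac1{\varepsilon^2}\sum_{K\in\mathcal M}|K|\,\Pi_\gamma(\rho^{n+1}_K|\tilde\rho_K)+\sum_{\sigma\in\mathcal E_{\rm int}}|D_\sigma|\tfrac12\rho^{n+1}_{D_\sigma}(u^{n+1}_\sigma)^2=0.$$ (ii) The scheme is well-balanced in the following sense: given the initial data $\rho^0=\tilde\rho$, $\boldsymbol u^0=\boldsymbol 0$, the scheme admits the unique stationary solution $(\tilde\rho,\boldsymbol 0)$; that is, its unique solution is $\rho^n=\tilde\rho$, $\boldsymbol u^n=\boldsymbol 0$ for all $0\le n\le N$.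
   Context: Notation: $\mathcal E_{\rm int}=\bigcup_i\mathcal E^{(i)}_{\rm int}$. Data. $d\in\{1,2,3\}$, $T>0$, $\gamma>1$, $\varepsilon\in(0,1]$; $\Omega\subset\mathbb R^d$ is a bounded open connected set whose closure is a finite union of closed axis-parallel intervals/rectangles/parallelepipeds. $\wp(\rho)=\rho^\gamma$, $h_\gamma(\rho)=\rho^\gamma/(\gamma-1)$ for $\rho>0$, $\Pi_\gamma(a|b)=h_\gamma(a)-h_\gamma(b)-h_\gamma'(b)(a-b)$. $\phi$ is a given smooth potential, and the hydrostatic density is $\tilde\rho(x)=\big(\frac{\gamma-1}{\gamma}(C(m_0)-\phi(x))\big)^{1/(\gamma-1)}$ (so $h_\gamma'(\tilde\rho)+\phi=C(m_0)$), where the constant $C(m_0)$ is determined by the total mass $m_0$; it is assumed bounded below by a positive constant on $\Omega$. Mesh. A MAC grid $\mathcal T=(\mathcal M,\mathcal E)$ consists of a partition $\mathcal M$ of $\bar\Omega$ into closed axis-parallel cells (conforming, possibly non-uniform) and the set $\mathcal E=\bigcup_{i=1}^d\mathcal E^{(i)}$ of their faces, $\mathcal E^{(i)}=\mathcal E^{(i)}_{\rm int}\cup\mathcal E^{(i)}_{\rm ext}$ being the (internal and external) faces orthogonal to the $i$-th canonical vector $e^{(i)}$. $\mathcal E(K)$ is the set of faces of $K$; $\sigma=K|L$ is the internal face common to $K,L$; $\boldsymbol\nu_{\sigma,K}$ is the unit normal to $\sigma$ outward to $K$. For $\sigma=K|L$ the dual cell is $D_\sigma=D_{\sigma,K}\cup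 D_{\sigma,L}$, with $D_{\sigma,K}$ the half of $K$ adjacent to $\sigma$ (for external $\sigma\in\mathcal E(K)$, $D_\sigma=D_{\sigma,K}$); $\tilde{\mathcal E}(D_\sigma)$ is the set of faces of $D_\sigma$, and $\epsilon=D_\sigma|D_{\sigma'}$ denotes a common dual face. $L_{\mathcal M}(\Omega)$: functions constant on each $K\in\mathcal M$. $\boldsymbol H_{\mathcal E,0}(\Omega)$: vector fields $\boldsymbol u$ whose $i$-th component is constant ($=u_\sigma$) on each $D_\sigma$, $\sigma\in\mathcal E^{(i)}$, and zero for $\sigma\in\mathcal E^{(i)}_{\rm ext}$. For $q\in L_{\mathcal M}(\Omega)$, $\sigma=K|L$: $|D_\sigma|q_{D_\sigma}=|D_{\sigma,K}|q_K+|D_{\sigma,L}|q_L$. Interface values and discrete gradient. For a positive $\rho\in L_{\mathcal M}(\Omega)$ and $\sigma=K|L$, $\rho_\sigma$ is the unique number between $\rho_K$ and $\rho_L$ with $\rho_K^\gamma-\rho_L^\gamma=\rho_\sigma(h_\gamma'(\rho_K)-h_\gamma'(\rho_L))$ if $\rho_K\ne\rho_L$, and $\rho_\sigma=\rho_K$ if $\rho_K=\rho_L$. For $\sigma=K|L\in\mathcal E^{(i)}_{\rm int}$, $(\partial^{(i)}_{\mathcal E}q)_\sigma=\frac{|\sigma|}{|D_\sigma|}(q_L-q_K)\,e^{(i)}\cdot\boldsymbol\nu_{\sigma,K}$. Discrete hydrostatic data: $\tilde\rho=\sum_K\tilde\rho_K\mathcal X_K\in L_{\mathcal M}(\Omega)$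 with $\tilde\rho_K=\frac1{|K|}\int_K\tilde\rho(x)\,dx$, and $\phi_K=C(m_0)-h_\gamma'(\tilde\rho_K)$. Fluxes. With $p^{n+1}_K=(\rho^{n+1}_K)^\gamma$ and a stabilisation parameter $\eta>0$, $\delta u^{n+1}_\sigma=\frac{\eta\,\delta t}{\varepsilon^2}\big[(\partial^{(i)}_{\mathcal E}p^{n+1})_\sigma+\rho^{n+1}_\sigma(\partial^{(i)}_{\mathcal E}\phi)_\sigma\big]$ for $\sigma\in\mathcal E^{(i)}_{\rm int}$, zero on external faces. $F_{\sigma,K}(\rho^{n+1},\boldsymbol u^n)=|\sigma|\rho^{n+1}_\sigma(u^n_\sigma-\delta u^{n+1}_\sigma)\,e^{(i)}\cdot\boldsymbol\nu_{\sigma,K}$ for $\sigma\in\mathcal E^{(i)}_{\rm int}$, zero on external faces. Dual fluxes $F_{\epsilon,\sigma}$ ($\sigma=K|L\in\mathcal E^{(i)}_{\rm int}$, $\epsilon\in\tilde{\mathcal E}(D_\sigma)$): zero if $\epsilon\subset\partial\Omega$; if $\epsilon\perp e^{(i)}$ lies in $K$, $F_{\epsilon,\sigma}=\frac12(F_{\sigma',K}-F_{\sigma,K})$ with $\sigma'$ the face of $K$ opposite to $\sigma$; otherwise $\epsilon$ consists of halves of faces $\tau\in\mathcal E(K)$, $\tau'\in\mathcal E(L)$ and $F_{\epsilon,\sigma}=\frac12(F_{\tau,K}+F_{\tau',L})$. For $\epsilon=D_\sigma|D_{\sigma'}$, $u^n_{\epsilon,\rm up}=u^n_\sigma$ if $F_{\epsilon,\sigma}\ge0$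 and $u^n_{\sigma'}$ otherwise. Scheme. $\delta t>0$, $N=\lfloor T/\delta t\rfloor$. Given $(\rho^n,\boldsymbol u^n)\in L_{\mathcal M}(\Omega)\times\boldsymbol H_{\mathcal E,0}(\Omega)$ with $\rho^n>0$, a solution is $(\rho^{n+1},\boldsymbol u^{n+1})$ in the same space with $\rho^{n+1}>0$ and (S1) $\frac1{\delta t}(\rho^{n+1}_K-\rho^n_K)+\frac1{|K|}\sum_{\sigma\in\mathcal E(K)}F_{\sigma,K}(\rho^{n+1},\boldsymbol u^n)=0$ for all $K\in\mathcal M$; (S2) $\frac1{\delta t}(\rho^{n+1}_{D_\sigma}u^{n+1}_\sigma-\rho^n_{D_\sigma}u^n_\sigma)+\frac1{|D_\sigma|}\sum_{\epsilon\in\tilde{\mathcal E}(D_\sigma)}F_{\epsilon,\sigma}(\rho^{n+1},\boldsymbol u^n)u^n_{\epsilon,\rm up}+\frac1{\varepsilon^2}(\partial^{(i)}_{\mathcal E}p^{n+1})_\sigma=-\frac1{\varepsilon^2}\rho^{n+1}_\sigma(\partial^{(i)}_{\mathcal E}\phi)_\sigma$ for all $\sigma\in\mathcal E^{(i)}_{\rm int}$, $1\le i\le d$. *)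

(* Defs.v *)
From HB Require Import structures.
From mathcomp Require Import all_boot all_order all_algebra finmap.
From mathcomp Require Import all_classical all_reals all_analysis.
Import Order.TTheory GRing.Theory Num.Theory.
Import numFieldNormedType.Exports.

Set Implicit Arguments.
Unset Strict Implicit.
Unset Printing Implicit Defensive.

Local Open Scope classical_set_scope.
Local Open Scope ring_scope.

(* A closed box prod_i [lo_i, hi_i] is the pair (lo, hi).  A face orthogonal   *)
(* to e^(i) is a box which is degenerate in direction i only.                 *)
Notation box R d := ('rV[R]_d * 'rV[R]_d)%type.

Section Boxes.
Variables (R : realType) (d : nat).
Implicit Types (B F K L : box R d) (i j : 'I_d) (b : bool).

Definition box_set B : set 'rV[R]_d :=
  [set x | forall i, B.1 0 i <= x 0 i <= B.2 0 i].

Definition nondegenerate_box B := forall i, B.1 0 i < B.2 0 i.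

Definition vol B : R := \prod_(i < d) (B.2 0 i - B.1 0 i).

(* (d-1)-dimensional measure of a face orthogonal to e^(i) *)
Definition area i B : R := \prod_(j < d | j != i) (B.2 0 j - B.1 0 j).

Definition mid B i : R := (B.1 0 i + B.2 0 i) / 2.

Definition set_coord (v : 'rV[R]_d) i (t : R) : 'rV[R]_d :=
  \row_j (if j == i then t else v 0 j).

(* [b = true] is the side of e^(i), [b = false] the side of -e^(i) *)
Definition facet B i b : box R d :=
  let t := (if b then B.2 else B.1) 0 i in
  (set_coord B.1 i t, set_coord B.2 i t).

(* e^(i) . nu for nu the outward normal to [facet B i b] *)
Definition nu b : R := if b then 1 else -1.

(* the half of B adjacent to [facet B i b] *)
Definition half B i b : box R d :=
  if b then (set_coord B.1 i (mid B i), B.2)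
  else (B.1, set_coord B.2 i (mid B i)).

(* faces of B of any dimension: vertices, edges, ..., B itself *)
Definition face_of F B := forall i,
  [\/ F.1 0 i = B.1 0 i /\ F.2 0 i = B.1 0 i,
      F.1 0 i = B.2 0 i /\ F.2 0 i = B.2 0 i |
      F.1 0 i = B.1 0 i /\ F.2 0 i = B.2 0 i].

Definition boundary (A : set 'rV[R]_d) := closure A `\` A°.

Definition domain (Omega : set 'rV[R]_d) :=
  [/\ open Omega, connected Omega, bounded_set Omega &
      exists s : seq (box R d),
        (forall B, B \in s -> nondegenerate_box B) /\
        closure Omega = \bigcup_(B in [set` s]) box_set B].

Definition conforming (M : {fset box R d}) := forall K L, K \in M -> L \in M ->
  box_set K `&` box_set L = set0 \/
  exists F, [/\ face_of F K, face_of F L & box_set F = box_set K `&` box_set L].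

Definition mac_grid (Omega : set 'rV[R]_d) (M : {fset box R d}) :=
  [/\ forall K, K \in M -> nondegenerate_box K,
      closure Omega = \bigcup_(K in [set` M]) box_set K,
      forall K L, K \in M -> L \in M -> K != L ->
        (box_set K)° `&` (box_set L)° = set0 &
      conforming M].

End Boxes.

Section Integral.
Variables (R : realType) (d : nat).
Implicit Types (A : set 'rV[R]_d) (f : 'rV[R]_d -> R).

Let leb := @lebesgue_measure R.
Let pt (s : seq R) : 'rV[R]_d := \row_(i < d) s`_i.

(* Lebesgue integral over A, in dimension 1, 2 or 3 (the value 0 for the      *)
(* other d is junk), w.r.t. the library's product Lebesgue measures.          *)
Definition lebesgue_int A f : \bar R :=
  match d with
  | 1 => \int[leb]_(x in [set x | A (pt [:: x])]) (f (pt [:: x]))%:E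
  | 2 => \int[leb \x leb]_(x in [set x | A (pt [:: x.1; x.2])])
           (f (pt [:: x.1; x.2]))%:E
  | 3 => \int[(leb \x leb) \x leb]_(x in
             [set x | A (pt [:: x.1.1; x.1.2; x.2])])
           (f (pt [:: x.1.1; x.1.2; x.2]))%:E
  | _ => 0
  end%E.

Definition cell_mean f (K : box R d) : R :=
  fine (lebesgue_int (box_set K) f) / vol K.

(* C^k on U: the iterated partial derivatives of order <= k exist and are     *)
(* continuous on U.                                                           *)
Fixpoint Ck (k : nat) (U : set 'rV[R]_d) f : Prop :=
  (forall x, U x -> {for x, continuous f}) /\
  if k is k'.+1 then
    forall i : 'I_d,
      (forall x, U x -> derivable f x (delta_mx 0 i)) /\
      Ck k' U (fun x => 'D_(delta_mx 0 i) f x)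
  else True.

(* C^infinity up to the boundary of Omega *)
Definition smooth_on_closure (Omega : set 'rV[R]_d) f :=
  exists U : set 'rV[R]_d,
    [/\ open U, closure Omega `<=` U & forall k, Ck k U f].

End Integral.

Section Thermodynamics.
Variables (R : realType) (gamma : R).

Definition pressure (r : R) : R := r `^ gamma.

Definition h_gamma (r : R) : R := r `^ gamma / (gamma - 1).

Definition Pi_gamma (a b : R) : R :=
  h_gamma a - h_gamma b - derive1 h_gamma b * (a - b).

(* the unique r between a and b with the stated property; [xget] returns the  *)
(* (junk) value a if there is none                                            *)
Definition rho_interface (a b : R) : R :=
  if a == b then a else
  xget a [set r | Num.min a b <= r <= Num.max a b /\
    pressure a - pressure b = r * (derive1 h_gamma a - derive1 h_gamma b)].

Definition hydrostatic d (phi : 'rV[R]_d -> R) (C : R) (x : 'rV[R]_d) : R :=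
  ((gamma - 1) / gamma * (C - phi x)) `^ (gamma - 1)^-1.

(* C = C(m0).  The first clause says that the real power in the definition    *)
(* of the hydrostatic density is meaningful (powR is junk on negative bases). *)
Definition hydrostatic_constant d (Omega : set 'rV[R]_d)
    (phi : 'rV[R]_d -> R) (m0 C : R) :=
  [/\ forall x, Omega x -> 0 <= C - phi x,
      exists2 c, 0 < c & forall x, Omega x -> c <= hydrostatic phi C x &
      lebesgue_int Omega (hydrostatic phi C) = m0%:E].

Definition rho_tilde d (phi : 'rV[R]_d -> R) (C : R) : box R d -> R :=
  cell_mean (hydrostatic phi C).

Definition phi_cell d (phi : 'rV[R]_d -> R) (C : R) (K : box R d) : R :=
  C - derive1 h_gamma (rho_tilde phi C K).

End Thermodynamics.

(* Functions of L_M(Omega) (resp. fields of H_E(Omega)) are given by their    *)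
(* values q K, K a cell (resp. u s, s a face; for s in E^(i) this is the value *)
(* of the i-th component on the dual cell of s).  Values at boxes which are   *)
(* neither cells nor faces of the grid are irrelevant.                        *)
Section Scheme.
Variables (R : realType) (d : nat) (Omega : set 'rV[R]_d) (M : {fset box R d}).
Implicit Types (q rho u : box R d -> R) (i j : 'I_d) (b : bool).
Implicit Types (s K : box R d).

Definition faces i : {fset box R d} :=
  ([fset facet K i false | K in M] `|` [fset facet K i true | K in M])%fset.

(* s = K|L with s the upper face of K and the lower face of L *)
Definition int_faces i : {fset box R d} :=
  [fset s in faces i |
    [&& s \in [fset facet K i true | K in M]%fset,
        s \in [fset facet L i false | L in M]%fset &
        ~~ `[< (box_set s `<=` boundary Omega)%classic >] ]]%fset.

(* The cell having s as a face and lying on its upper ([b = true]) or lower   *)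
(* ([b = false]) side; it is s itself if there is no such cell.               *)
Definition adj i s b : box R d :=
  head s [seq K <- M | facet K i (~~ b) == s].

(* The dual cell D_s: since adj defaults to s, a missing half is degenerate.  *)
Definition dual i s : box R d :=
  (set_coord s.1 i (mid (adj i s false) i),
   set_coord s.2 i (mid (adj i s true) i)).

(* q_{D_s} *)
Definition dual_mean q i s : R :=
  (vol (half (adj i s false) i true) * q (adj i s false) +
   vol (half (adj i s true) i false) * q (adj i s true)) / vol (dual i s).

(* For s = K|L with K below L, e^(i) . nu_{s,K} = 1. *)
Definition discrete_grad q i s : R :=
  area i s / vol (dual i s) * (q (adj i s true) - q (adj i s false)).

Definition H_E0 u := forall i s, s \in faces i -> s \notin int_faces i -> u s = 0.

Variables (gamma eps eta dt : R) (phi : box R d -> R).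

Definition rho_face rho i s : R :=
  rho_interface gamma (rho (adj i s false)) (rho (adj i s true)).

Definition balance rho i s : R :=
  discrete_grad (fun K => pressure gamma (rho K)) i s +
  rho_face rho i s * discrete_grad phi i s.

Definition delta_u rho i s : R :=
  if s \in int_faces i then eta * dt / eps ^+ 2 * balance rho i s else 0.

(* F_{s,K}(rho, u) for s = facet K i b *)
Definition flux rho u K i b : R :=
  let s := facet K i b in
  if s \in int_faces i then
    area i s * rho_face rho i s * (u s - delta_u rho i s) * nu R b
  else 0.

(* F_{epsilon,s} for epsilon = facet (dual i s) j b *)
Definition dual_flux rho u i s j b : R :=
  if `[< box_set (facet (dual i s) j b) `<=` boundary Omega >] then 0
  else if j == i then
    (flux rho u (adj i s b) i b - flux rho u (adj i s b) i (~~ b)) / 2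
  else
    (flux rho u (adj i s false) j b + flux rho u (adj i s true) j b) / 2.

(* The face s' with epsilon = D_s|D_s', epsilon = facet (dual i s) j b.  At a *)
(* reentrant edge of Omega, D_s' is a half cell and its facet a part of       *)
(* epsilon only, hence the inclusion.                                         *)
Definition dual_neighbour i s j b : box R d :=
  head s [seq s' <- faces i | (s' != s) &&
    `[< box_set (facet (dual i s') j (~~ b)) `<=`
        box_set (facet (dual i s) j b) >] ].

Definition upwind rho u i s j b : R :=
  if 0 <= dual_flux rho u i s j b then u s else u (dual_neighbour i s j b).

Definition mass_eq rho u rho' := forall K, K \in M ->
  (rho' K - rho K) / dt +
  (vol K)^-1 * \sum_(i < d) \sum_(b : bool) flux rho' u K i b = 0.

Definition momentum_eq rho u rho' u' := forall i s, s \in int_faces i ->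
  (dual_mean rho' i s * u' s - dual_mean rho i s * u s) / dt +
  (vol (dual i s))^-1 * (\sum_(j < d) \sum_(b : bool)
     dual_flux rho' u i s j b * upwind rho' u i s j b) +
  (eps ^+ 2)^-1 * discrete_grad (fun K => pressure gamma (rho' K)) i s =
  - (eps ^+ 2)^-1 * (rho_face rho' i s * discrete_grad phi i s).

(* (rho', u') solves the scheme with data (rho, u) *)
Definition scheme_step rho u rho' u' :=
  [/\ forall K, K \in M -> 0 < rho' K, H_E0 u',
      mass_eq rho u rho' & momentum_eq rho u rho' u'].

(* (rho n, u n), 0 <= n <= N, solves the scheme with initial data (rho0, u0) *)
Definition scheme_solution (N : nat) rho0 u0 (rho u : nat -> box R d -> R) :=
  [/\ forall K, K \in M -> rho 0%N K = rho0 K,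
      forall i s, s \in faces i -> u 0%N s = u0 s &
      forall n, (n < N)%N -> scheme_step (rho n) (u n) (rho n.+1) (u n.+1)].

Definition relative_energy rho_t rho u : R :=
  (eps ^+ 2)^-1 * \sum_(K <- M) vol K * Pi_gamma gamma (rho K) (rho_t K) +
  \sum_(i < d) \sum_(s <- int_faces i)
    vol (dual i s) * (2^-1 * dual_mean rho i s * u s ^+ 2).

End Scheme.

(* Main.v *)
Require Import Defs.
From HB Require Import structures.
From mathcomp Require Import all_boot all_order all_algebra finmap.
From mathcomp Require Import ring.
From mathcomp Require Import all_classical all_reals all_analysis.
Import Order.TTheory GRing.Theory Num.Theory.
Import numFieldNormedType.Exports.
Local Open Scope classical_set_scope.
Local Open Scope ring_scope.

(** Write h' for the derivative of h_gamma.  The discrete potential is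
    phi_K = C - h'(rt_K), rt being the discrete hydrostatic density, and the
    interface density rho_s is chosen exactly so that the pressure difference
    across s is rho_s times the difference of h'(rho).  Hence the force that
    drives the stabilised mass flux is, on every internal face,
      (area / dual volume) * rho_s * (psi_L - psi_K),
    where psi = h'(rho) - h'(rt) measures the departure from equilibrium
    ([balance_drive]).  This one identity carries the well-balancing.

    Equilibrium is a solution: for rho = rt, psi vanishes, so that with zero
    velocity all fluxes vanish and the momentum equation reduces to the balance
    ([equilibrium_scheme_step]).

    It is the only one: a step from (rt, 0) has a purely diffusive mass flux, a
    nonnegative multiple of psi_K - psi_L out of K ([flux_drive]).  At a cell
    where psi is maximal all the fluxes leave, so that the new density is at
    most rt there; as h' is increasing, max psi <= 0.  Symmetrically,
    min psi >= 0 ([mass_eq_equilibrium]).  With rho' = rt the fluxes and the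
    balance vanish, and the momentum equation leaves (dual mean) * u' = 0
    ([scheme_step_equilibrium]).  Induction on the time step concludes.

    The relative energy is a sum of nonnegative terms: h_gamma is strictly
    convex, so that Pi_gamma (a | b) is positive unless a = b, and the dual
    volumes and dual means of a positive density are positive
    ([relative_energy_eq0]).

    All this needs rt > 0 ([rho_tilde_gt0]).  The hydrostatic density is bounded
    below by a positive constant on Omega, hence on the closed cells by
    continuity, and it is bounded above on each of them by compactness, so that
    its mean is finite and positive.  Part of the geometry is also needed: a
    face determines the cell on each of its sides ([facet_inj]), because two
    cells on the same side of a face would have overlapping interiors. *)

Set Implicit Arguments.
Unset Strict Implicit.

(** * Thermodynamics *)

Lemma derive1_h_gamma (R : realType) (gamma r : R) : 1 < gamma -> 0 < r ->
  derive1 (h_gamma gamma) r = gamma / (gamma - 1) * r `^ (gamma - 1).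
Proof.
move=> g1 r0; rewrite derive1E /h_gamma.
have D := is_derive1_powR gamma r0.
have -> : (fun s : R => s `^ gamma / (gamma - 1)) =
          (gamma - 1)^-1 \*: ((@powR R) ^~ gamma : R -> R).
  by apply/funext => s /=; rewrite /GRing.scale /= mulrC.
rewrite deriveZ//= (@derive_val _ _ _ _ _ _ _ D) /GRing.scale /=.
by rewrite mulrA (mulrC _ gamma).
Qed.

Lemma h_gamma_is_derive (R : realType) (gamma r : R) : 1 < gamma -> 0 < r ->
  is_derive r 1 (h_gamma gamma) (derive1 (h_gamma gamma) r).
Proof.
move=> g1 r0; rewrite derive1E; apply: derivableP.
have D := is_derive1_powR gamma r0.
have -> : h_gamma gamma = (gamma - 1)^-1 \*: ((@powR R) ^~ gamma : R -> R).
  by apply/funext => s /=; rewrite /h_gamma /GRing.scale /= mulrC.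
exact: derivableZ.
Qed.

Lemma derive1_h_gamma_lt (R : realType) (gamma a b : R) : 1 < gamma -> 0 < a ->
  a < b -> derive1 (h_gamma gamma) a < derive1 (h_gamma gamma) b.
Proof.
move=> g1 a0 ab; have b0 := lt_trans a0 ab.
rewrite !derive1_h_gamma// ltr_pM2l; last first.
  by rewrite divr_gt0// ?subr_gt0// (lt_trans _ g1).
by apply: gt0_ltr_powR; rewrite ?subr_gt0// nnegrE ltW.
Qed.

Lemma derive1_h_gamma_le (R : realType) (gamma a b : R) :
  1 < gamma -> 0 < a -> 0 < b ->
  (derive1 (h_gamma gamma) a <= derive1 (h_gamma gamma) b) = (a <= b).
Proof.
move=> g1 a0 b0; case: (ltrgtP a b) => [ab|ba|->]; last by rewrite lexx.
- by rewrite ltW// derive1_h_gamma_lt.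
- by rewrite leNgt derive1_h_gamma_lt.
Qed.

Lemma Pi_gammaxx (R : realType) (gamma a : R) : Pi_gamma gamma a a = 0.
Proof. by rewrite /Pi_gamma !subrr mulr0 subrr. Qed.

Lemma h_gamma_MVT (R : realType) (gamma a b : R) : 1 < gamma -> 0 < a ->
  a < b -> exists2 c, a < c < b &
  h_gamma gamma b - h_gamma gamma a = derive1 (h_gamma gamma) c * (b - a).
Proof.
move=> g1 a0 ab.
have D (x : R) : 0 < x -> is_derive x 1 (h_gamma gamma) (derive1 (h_gamma gamma) x).
  exact: h_gamma_is_derive.
have [||c cab E] := @MVT R (h_gamma gamma) (derive1 (h_gamma gamma)) a b ab.
- by move=> x; rewrite in_itv/= => /andP[ax _]; apply: D; apply: lt_trans ax.
- apply: derivable_within_continuous => x; rewrite in_itv/= => /andP[ax _].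
  by have [] := D x (lt_le_trans a0 ax).
by exists c => //; rewrite in_itv/= in cab.
Qed.

(** Strict convexity of h_gamma: by the mean value theorem, Pi_gamma a b is
    (h'(c) - h'(b)) (a - b) for some c strictly between a and b. *)
Lemma Pi_gamma_gt0 (R : realType) (gamma a b : R) :
  1 < gamma -> 0 < a -> 0 < b -> a != b -> 0 < Pi_gamma gamma a b.
Proof.
move=> g1 a0 b0; rewrite /Pi_gamma neq_lt => /orP[ab|ba].
- have [c /andP[ac cb] E] := h_gamma_MVT g1 a0 ab.
  have swap (x y k l : R) : y - x = k * (b - a) ->
      x - y - l * (a - b) = (l - k) * (b - a).
    by move=> e; rewrite -(opprB y) e; ring.
  rewrite (swap _ _ _ _ E).
  by rewrite mulr_gt0 ?subr_gt0// derive1_h_gamma_lt// (lt_trans a0).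
- have [c /andP[bc ca] E] := h_gamma_MVT g1 b0 ba.
  rewrite E -mulrBl.
  by rewrite mulr_gt0 ?subr_gt0// derive1_h_gamma_lt.
Qed.

Lemma Pi_gamma_ge0 (R : realType) (gamma a b : R) :
  1 < gamma -> 0 < a -> 0 < b -> 0 <= Pi_gamma gamma a b.
Proof.
move=> g1 a0 b0; have [->|ab] := eqVneq a b; first by rewrite Pi_gammaxx.
by rewrite ltW// Pi_gamma_gt0.
Qed.

Lemma pressure_h_gamma (R : realType) (gamma r : R) : 1 < gamma -> 0 < r ->
  pressure gamma r = r * derive1 (h_gamma gamma) r - h_gamma gamma r.
Proof.
move=> g1 r0; rewrite derive1_h_gamma// /pressure /h_gamma.
have -> : r `^ gamma = r * r `^ (gamma - 1).
  by rewrite -{2}(powRr1 (ltW r0)) -powRD ?(gt_eqF r0) ?implybT// addrC subrK.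
have : gamma - 1 != 0 by rewrite subr_eq0 gt_eqF.
move: (r `^ _) => y; move=> g0.
by field.
Qed.

(** The pressure is the Legendre transform r h' - h, so that the defect in
    replacing the interface density by the value a is a Bregman divergence. *)
Lemma pressure_subE (R : realType) (gamma a b : R) :
  1 < gamma -> 0 < a -> 0 < b ->
  pressure gamma b - pressure gamma a =
    a * (derive1 (h_gamma gamma) b - derive1 (h_gamma gamma) a) +
    Pi_gamma gamma a b.
Proof.
move=> g1 a0 b0; rewrite !pressure_h_gamma// /Pi_gamma.
move: (h_gamma gamma a) (h_gamma gamma b) (derive1 _ a) (derive1 _ b).
by move=> *; ring.
Qed.

(** The quotient q of the two differences lies between a and b because, by
    [pressure_subE], q - a and q - b are Bregman divergences, which are
    nonnegative, divided by h'(b) - h'(a) and h'(a) - h'(b) respectively.  So the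
    set from which the interface value is chosen is not empty. *)
Lemma rho_interfaceP (R : realType) (gamma a b : R) :
  1 < gamma -> 0 < a -> 0 < b ->
  0 < rho_interface gamma a b /\
  pressure gamma a - pressure gamma b = rho_interface gamma a b *
    (derive1 (h_gamma gamma) a - derive1 (h_gamma gamma) b).
Proof.
move=> g1 a0 b0; rewrite /rho_interface; case: eqVneq => [->|ab].
  by rewrite !subrr mulr0.
pose h' := derive1 (h_gamma gamma).
pose q := (pressure gamma a - pressure gamma b) / (h' a - h' b).
have hab : h' a - h' b != 0.
  rewrite subr_eq0; move: ab; rewrite !neq_lt => /orP[ab|ba]; apply/orP.
    by left; exact: derive1_h_gamma_lt.
  by right; exact: derive1_h_gamma_lt.
have qE : pressure gamma a - pressure gamma b = q * (h' a - h' b).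
  by rewrite /q divfK.
have quot (p p' h k x P : R) : h - k != 0 ->
    p - p' = x * (h - k) + P -> (p - p') / (h - k) - x = P / (h - k).
  by move=> nz ->; rewrite mulrDl mulfK// addrAC subrr add0r.
have swap (p p' h k x P : R) :
    p' - p = x * (k - h) + P -> p - p' = x * (h - k) - P.
  by move=> E; rewrite -(opprB p') E opprD -mulrN opprB.
have qb : q - b = Pi_gamma gamma b a / (h' a - h' b).
  by apply: quot hab _; exact: pressure_subE.
have qa : q - a = - Pi_gamma gamma a b / (h' a - h' b).
  by apply: quot hab _; apply: swap; exact: pressure_subE.
have Pab := Pi_gamma_ge0 g1 a0 b0; have Pba := Pi_gamma_ge0 g1 b0 a0.
have qab : Num.min a b <= q <= Num.max a b.
  move: ab; rewrite neq_lt => /orP[ab|ba].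
    have hn : (h' a - h' b)^-1 <= 0.
      by rewrite invr_le0 subr_le0 ltW// derive1_h_gamma_lt.
    rewrite (min_idPl (ltW ab)) (max_idPr (ltW ab)) -subr_ge0 qa.
    by rewrite -[q <= b]subr_le0 qb mulr_le0 ?oppr_le0// mulr_ge0_le0.
  have hp : 0 <= (h' a - h' b)^-1.
    by rewrite invr_ge0 subr_ge0 ltW// derive1_h_gamma_lt.
  rewrite (min_idPr (ltW ba)) (max_idPl (ltW ba)) -subr_ge0 qb.
  by rewrite -[q <= a]subr_le0 qa mulNr oppr_le0 !mulr_ge0.
case: xgetP => [r rE [/andP[mr _] E]|/(_ q)]; last by case.
by split=> //; apply: lt_le_trans mr; rewrite lt_min a0 b0.
Qed.

(** * Positivity of the discrete hydrostatic density *)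

(** Monotonicity without measurability: the integral of a nonnegative function
    is a supremum over the simple functions below it, and enlarging the function
    enlarges that set. *)
Lemma nonneg_le_integral (R : realType) (d : measure_display)
    (T : measurableType d) (mu : {measure set T -> \bar R}) (D : set T)
    (f g : T -> \bar R) :
  (forall x, D x -> (0 <= f x)%E) -> (forall x, D x -> (f x <= g x)%E) ->
  (\int[mu]_(x in D) f x <= \int[mu]_(x in D) g x)%E.
Proof.
move=> f0 fg; have g0 x : D x -> (0 <= g x)%E.
  by move=> Dx; apply: le_trans (fg x Dx); exact: f0.
rewrite !ge0_integralE//; apply: ereal_sup_le => _ [k /= kf <-].
exists k => //= x; apply: le_trans (kf x) _.
exact: lee_restrict.
Qed.

(** The upper bound B matters: the real part of an infinite integral is 0. *)
Lemma fine_integral_gt0 (R : realType) (d : measure_display)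
    (T : measurableType d) (mu : {measure set T -> \bar R}) (D : set T)
    (f : T -> R) (m B v : R) :
  measurable D -> mu D = v%:E -> 0 < v -> 0 < m ->
  (forall x, D x -> m <= f x <= B) ->
  0 < fine (\int[mu]_(x in D) (f x)%:E).
Proof.
move=> mD Dv v0 m0 mfB.
have lo : ((m * v)%:E <= \int[mu]_(x in D) (f x)%:E)%E.
  rewrite EFinM -Dv -(integral_cst mu mD); apply: nonneg_le_integral => x Dx.
    by rewrite lee_fin ltW.
  by rewrite lee_fin; case/andP: (mfB x Dx).
have hi : (\int[mu]_(x in D) (f x)%:E <= (B * v)%:E)%E.
  rewrite EFinM -Dv -(integral_cst mu mD); apply: nonneg_le_integral => x Dx.
    by rewrite lee_fin (le_trans (ltW m0))//; case/andP: (mfB x Dx).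
  by rewrite lee_fin; case/andP: (mfB x Dx).
have If : (\int[mu]_(x in D) (f x)%:E)%E \is a fin_num.
  rewrite fin_numE gt_eqF ?lt_eqF//.
  - by apply: le_lt_trans hi _; rewrite ltry.
  - by apply: lt_le_trans lo; rewrite ltNyr.
rewrite -lte_fin fineK//; apply: lt_le_trans lo.
by rewrite lte_fin mulr_gt0.
Qed.

Lemma lebesgue_measure_segment (R : realType) (a b : R) : a < b ->
  (lebesgue_measure : {measure set _ -> \bar R}) `[a, b]%classic = (b - a)%:E.
Proof. by move=> ab; rewrite /= lebesgue_measure_itv/= lte_fin ab. Qed.

(** In each dimension the box is, in coordinates, a product of segments. *)
Lemma lebesgue_int_box_gt0 (R : realType) (d : nat) (K : box R d)
    (f : 'rV[R]_d -> R) (m B : R) :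
  (1 <= d <= 3)%N -> nondegenerate_box K -> 0 < m ->
  (forall x, box_set K x -> m <= f x <= B) ->
  0 < fine (lebesgue_int (box_set K) f).
Proof.
case: d K f => [|[|[|[|//]]]] K f // _ nK m0 mfB; rewrite /lebesgue_int.
- pose v := K.2 0 ord0 - K.1 0 ord0.
  have E : [set x | box_set K (\row_(i < 1) [:: x]`_i)] =
           `[K.1 0 ord0, K.2 0 ord0]%classic.
    apply/seteqP; split=> x /=; rewrite in_itv/=.
      by move=> /(_ ord0); rewrite mxE.
    by move=> Kx i; rewrite mxE (ord1 i).
  apply: (@fine_integral_gt0 _ _ _ lebesgue_measure _ _ m B v) => //.
  + by rewrite E; exact: measurable_itv.
  + by rewrite E lebesgue_measure_segment.
  + by rewrite subr_gt0.
  + by move=> x /mfB.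
- pose j : 'I_2 := lift ord0 ord0.
  pose v := (K.2 0 ord0 - K.1 0 ord0) * (K.2 0 j - K.1 0 j).
  have E : [set x | box_set K (\row_(i < 2) [:: x.1; x.2]`_i)] =
      `[K.1 0 ord0, K.2 0 ord0]%classic `*` `[K.1 0 j, K.2 0 j]%classic.
    apply/seteqP; split=> x /=; rewrite !in_itv/=.
      by move=> Kx; split; [have := Kx ord0|have := Kx j]; rewrite mxE.
    case=> K0 K1 i; rewrite mxE; case: (unliftP ord0 i) => [k|] ->//=.
    by rewrite (ord1 k).
  apply: (@fine_integral_gt0 _ _ _
    (lebesgue_measure \x lebesgue_measure)%E _ _ m B v) => //.
  + by rewrite E; apply: measurableX; exact: measurable_itv.
  + rewrite E; apply: etrans.
      by apply: product_measure1E; exact: measurable_itv.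
    by rewrite !lebesgue_measure_segment.
  + by rewrite mulr_gt0 ?subr_gt0.
  + by move=> x /mfB.
- pose j : 'I_3 := lift ord0 ord0.
  pose k : 'I_3 := lift ord0 (lift ord0 ord0).
  pose v := (K.2 0 ord0 - K.1 0 ord0) * (K.2 0 j - K.1 0 j) *
            (K.2 0 k - K.1 0 k).
  have E : [set x | box_set K (\row_(i < 3) [:: x.1.1; x.1.2; x.2]`_i)] =
      (`[K.1 0 ord0, K.2 0 ord0]%classic `*` `[K.1 0 j, K.2 0 j]%classic) `*`
      `[K.1 0 k, K.2 0 k]%classic.
    apply/seteqP; split=> x /=; rewrite !in_itv/=.
      move=> Kx.
      by split; [split; [have := Kx ord0|have := Kx j]|have := Kx k]; rewrite mxE.
    case=> [[K0 K1] K2] i; rewrite mxE; case: (unliftP ord0 i) => [l|] ->//=.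
    by case: (unliftP ord0 l) => [l'|] ->//=; rewrite (ord1 l').
  apply: (@fine_integral_gt0 _ _ _
    ((lebesgue_measure \x lebesgue_measure) \x lebesgue_measure)%E
    _ _ m B v) => //.
  + by rewrite E; repeat apply: measurableX; exact: measurable_itv.
  + rewrite E; apply: etrans.
      apply: product_measure1E; last exact: measurable_itv.
      by apply: measurableX; exact: measurable_itv.
    rewrite [X in (X * _)%E](_ : _ = ((K.2 0 ord0 - K.1 0 ord0) *
      (K.2 0 j - K.1 0 j))%:E) ?lebesgue_measure_segment//.
    apply: etrans; first by apply: product_measure1E; exact: measurable_itv.
    by rewrite !lebesgue_measure_segment.
  + by rewrite !mulr_gt0 ?subr_gt0.
  + by move=> x /mfB.
Qed.

Lemma box_set_compact (R : realType) (d : nat) (K : box R d) :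
  compact (box_set K).
Proof.
have := @rV_compact R d (fun i => `[K.1 0 i, K.2 0 i]%classic)
  (fun i => @segment_compact R _ _).
suff -> : box_set K = [set v : 'rV[R]_d |
    forall i, `[K.1 0 i, K.2 0 i]%classic (v ord0 i)] by [].
by apply/seteqP; split=> x Kx i; have := Kx i; rewrite /= in_itv.
Qed.

Lemma le_closure (R : realType) (T : topologicalType) (A : set T) (f : T -> R)
    (t : R) (x : T) :
  {for x, continuous f} -> closure A x -> (forall y, A y -> f y <= t) -> f x <= t.
Proof.
move=> fx Ax ft; rewrite leNgt; apply/negP => tx.
have nt : nbhs (f x) [set z | t < z] by apply: open_nbhs_nbhs; split.
have [y [Ay /=]] := Ax _ (fx _ nt).
by rewrite ltNge ft.
Qed.

(** A cell lies in the closure of Omega only (Omega may have slits), so the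
    lower bound on Omega has to be extended by continuity of phi.  This is done
    for the affine function X of phi whose power is the hydrostatic density. *)
Lemma rho_tilde_gt0 (R : realType) (d : nat) (hd : (1 <= d <= 3)%N)
    (Omega : set 'rV[R]_d) (M : {fset box R d}) (hM : mac_grid Omega M)
    (gamma : R) (hgamma : 1 < gamma) (phi : 'rV[R]_d -> R)
    (hphi : smooth_on_closure Omega phi)
    (m0 C : R) (hC : hydrostatic_constant gamma Omega phi m0 C) K :
  K \in M -> 0 < rho_tilde gamma phi C K.
Proof.
move=> KM; case: hM => nd cl _ _; case: hC => Cphi [c c0 hc] _.
case: hphi => U [_ clU /(_ 0%N)[phic _]].
have KO : box_set K `<=` closure Omega by rewrite cl => x Kx; exists K.
have g0 : 0 < gamma - 1 by rewrite subr_gt0.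
have gg : 0 < (gamma - 1) / gamma by rewrite divr_gt0// (lt_trans _ hgamma).
pose X x := (gamma - 1) / gamma * (C - phi x).
have XO x : Omega x -> c `^ (gamma - 1) <= X x.
  move=> Ox; have X0 : 0 <= X x by rewrite mulr_ge0 ?(ltW gg)// subr_ge0 -subr_ge0 Cphi.
  have -> : X x = hydrostatic gamma phi C x `^ (gamma - 1).
    by rewrite /hydrostatic -powRrM mulVf ?lt0r_neq0// powRr1.
  by apply: ge0_ler_powR; rewrite ?nnegrE ?powR_ge0 ?(ltW g0) ?(ltW c0)// hc.
have XK x : box_set K x -> c `^ (gamma - 1) <= X x.
  move=> Kx; rewrite -lerN2 -subr_ge0 opprK.
  have : phi x <= C - ((gamma - 1) / gamma)^-1 * c `^ (gamma - 1).
    apply: (le_closure (A := Omega)); [|exact: KO|].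
      by apply: phic; apply: clU; exact: KO.
    move=> y Oy; rewrite lerBrDr -lerBrDl ler_pdivrMl//; exact: XO.
  by rewrite lerBrDr -lerBrDl ler_pdivrMl// -subr_ge0 addrC.
have [Bd HB] : exists Bd, forall x, box_set K x -> hydrostatic gamma phi C x <= Bd.
  have cphi : {within box_set K, continuous phi}.
    apply: continuous_in_subspaceT => x; rewrite inE => Kx.
    by apply: phic; apply: clU; exact: KO.
  have [N [_ /(_ (N + 1))]] :=
    compact_bounded (continuous_compact cphi (@box_set_compact _ _ K)).
  rewrite ltrDl ltr01 => /(_ isT) HN.
  exists (((gamma - 1) / gamma * (C + (N + 1))) `^ (gamma - 1)^-1) => x Kx.
  have XB : X x <= (gamma - 1) / gamma * (C + (N + 1)).
    rewrite ler_pM2l// lerD2l lerNl.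
    by have := HN _ (imageP _ Kx); rewrite /= ler_norml => /andP[].
  have X0 : 0 <= X x by apply: le_trans (XK x Kx); exact: powR_ge0.
  apply: ge0_ler_powR => //; rewrite ?nnegrE ?invr_ge0 ?(ltW g0)//.
  exact: le_trans XB.
rewrite /rho_tilde /cell_mean divr_gt0//; last first.
  by apply: prodr_gt0 => i _; rewrite subr_gt0; exact: nd.
apply: (@lebesgue_int_box_gt0 _ _ _ _ c Bd) => // [|x Kx]; first exact: nd.
rewrite HB// andbT.
have -> : c = (c `^ (gamma - 1)) `^ (gamma - 1)^-1.
  by rewrite -powRrM mulfV ?lt0r_neq0// powRr1// ltW.
have h0 := powR_ge0 c (gamma - 1).
apply: ge0_ler_powR; rewrite ?nnegrE ?invr_ge0 ?(ltW g0)//; last exact: XK.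
exact: le_trans (XK x Kx).
Qed.

(** * Geometry of the grid *)

Lemma open_box_sub_interior (R : realType) (d : nat) (K : box R d)
    (x : 'rV[R]_d) :
  (forall i, K.1 0 i < x 0 i < K.2 0 i) -> (box_set K)° x.
Proof.
move=> Kx; apply: (@filter_forall _ _
  (fun i (y : 'rV[R]_d) => K.1 0 i <= y 0 i <= K.2 0 i) (nbhs x)) => i.
have /andP[lo hi] := Kx i.
have cx : {for x, continuous (fun y : 'rV[R]_d => y 0 i)} by exact: coord_continuous.
near=> y; apply/andP; split; apply: ltW.
- by near: y; exact: (cvgr_gt _ cx _ lo).
- by near: y; exact: (cvgr_lt _ cx _ hi).
Unshelve. all: by end_near. Qed.

Lemma set_coordE (R : realType) (d : nat) (v : 'rV[R]_d) i t j :
  set_coord v i t 0 j = if j == i then t else v 0 j.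
Proof. by rewrite /set_coord mxE. Qed.

Lemma vol_gt0 (R : realType) (d : nat) (K : box R d) :
  nondegenerate_box K -> 0 < vol K.
Proof. by move=> nK; apply: prodr_gt0 => i _; rewrite subr_gt0. Qed.

Section MacGrid.
Context {R : realType} {d : nat} {Omega : set 'rV[R]_d} {M : {fset box R d}}.
Hypothesis hM : mac_grid Omega M.
Implicit Types (K L s : box R d) (i j : 'I_d) (b : bool).

Lemma cell_lt K i : K \in M -> K.1 0 i < K.2 0 i.
Proof. by case: hM => nd _ _ _ KM; exact: nd. Qed.

(** Two cells with the same face on the same side both contain the points close
    enough to that face on this side; the centre of their intersection is
    interior to both. *)
Lemma facet_inj K L i b : K \in M -> L \in M -> facet K i b = facet L i b -> K = L.
Proof.
move=> KM LM E; apply/eqP; apply/negPn/negP => KL.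
case: hM => _ _ /(_ K L KM LM KL) D _.
have E1 j : (facet K i b).1 0 j = (facet L i b).1 0 j by rewrite E.
have E2 j : (facet K i b).2 0 j = (facet L i b).2 0 j by rewrite E.
pose lo j := Num.max (K.1 0 j) (L.1 0 j).
pose hi j := Num.min (K.2 0 j) (L.2 0 j).
have lohi j : lo j < hi j.
  rewrite /lo /hi gt_max !lt_min !cell_lt//= andbT.
  have := cell_lt j KM; have := cell_lt j LM.
  have := E1 j; have := E2 j; rewrite /facet !set_coordE /=.
  case: eqP => [->|_]; last by move=> -> -> *; apply/andP.
  by case: (b) => -> _ *; apply/andP.
pose x : 'rV[R]_d := \row_j ((lo j + hi j) / 2).
have xlo j : lo j < x 0 j by rewrite mxE midf_lt.
have xhi j : x 0 j < hi j by rewrite mxE midf_lt.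
suff : ((box_set K)° `&` (box_set L)°) x by rewrite D.
split; apply: open_box_sub_interior => j; have := xlo j; have := xhi j.
  by rewrite lt_min gt_max => /andP[-> _] /andP[-> _].
by rewrite lt_min gt_max => /andP[_ ->] /andP[_ ->].
Qed.

Lemma adj_facet K i b : K \in M -> adj M i (facet K i b) (~~ b) = K.
Proof.
move=> KM; rewrite /adj negbK.
have : K \in [seq L <- M | facet L i b == facet K i b].
  by rewrite mem_filter eqxx.
case E : [seq _ <- _ | _] => [|L r] // _ /=.
have : L \in [seq L <- M | facet L i b == facet K i b] by rewrite E mem_head.
by rewrite mem_filter => /andP[/eqP E2 LM]; exact: facet_inj E2.
Qed.

(** An internal face s = K|L recovers K and L as its lower and upper neighbour,
    so that the default value of [adj] never occurs there. *)
Lemma int_face_cells i s : s \in int_faces Omega M i ->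
  [/\ adj M i s false \in M, adj M i s true \in M,
      facet (adj M i s false) i true = s & facet (adj M i s true) i false = s].
Proof.
rewrite !inE /= => /andP[_ /and3P[/imfsetP[K /= KM ->] /imfsetP[L /= LM E] _]].
have aK : adj M i (facet K i true) false = K by exact: (adj_facet i true KM).
have aL : adj M i (facet K i true) true = L.
  by rewrite E; exact: (adj_facet i false LM).
by rewrite aK aL.
Qed.

Lemma int_faces_sub i s : s \in int_faces Omega M i -> s \in faces M i.
Proof. by rewrite inE /= => /andP[]. Qed.

Lemma area_gt0 i s : s \in int_faces Omega M i -> 0 < area i s.
Proof.
move=> /int_face_cells[KM _ <- _]; apply: prodr_gt0 => j /negbTE ji.
by rewrite /facet !set_coordE ji subr_gt0 cell_lt.
Qed.

Lemma mid_in_cell K i : K \in M -> K.1 0 i < mid K i < K.2 0 i.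
Proof. by move=> KM; rewrite /mid !midf_lt ?cell_lt. Qed.

Lemma vol_cell_gt0 K : K \in M -> 0 < vol K.
Proof. by move=> KM; apply: vol_gt0 => i; exact: cell_lt. Qed.

Lemma vol_half_gt0 K i b : K \in M -> 0 < vol (Defs.half K i b).
Proof.
move=> KM; apply: vol_gt0 => j; have /andP[lo hi] := mid_in_cell i KM.
by case: b; rewrite /Defs.half /= set_coordE;
  case: eqP => [->|_] //; exact: cell_lt.
Qed.

(** The midpoints of K and L in direction i lie on opposite sides of K|L. *)
Lemma vol_dual_gt0 i s : s \in int_faces Omega M i -> 0 < vol (dual M i s).
Proof.
move=> /int_face_cells[]; rewrite /dual.
move: (adj M i s false) (adj M i s true) => K L KM LM sK sL.
apply: vol_gt0 => j; rewrite !set_coordE.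
case: eqP => [_|/eqP/negbTE ji].
  have /andP[_ Kmid] := mid_in_cell i KM; have /andP[Lmid _] := mid_in_cell i LM.
  apply: lt_trans Kmid _; apply: le_lt_trans Lmid.
  have : (facet K i true).1 0 i = (facet L i false).1 0 i by rewrite sK sL.
  by rewrite /facet !set_coordE eqxx => ->.
by rewrite -sK /facet !set_coordE ji cell_lt.
Qed.

Lemma dual_mean_gt0 (q : box R d -> R) i s :
  (forall K, K \in M -> 0 < q K) -> s \in int_faces Omega M i ->
  0 < dual_mean M q i s.
Proof.
move=> q0 si; have [KM LM _ _] := int_face_cells si.
by rewrite divr_gt0 ?vol_dual_gt0// addr_gt0// mulr_gt0 ?vol_half_gt0 ?q0.
Qed.

End MacGrid.

(** * Departure of the scheme from hydrostatic equilibrium *)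

(** Evaluate the hypothesis at a maximum point of psi. *)
Lemma max_principle (T : choiceType) (R : realDomainType) (A : {fset T})
    (psi : T -> R) :
  (forall x, x \in A -> (forall y, y \in A -> psi y <= psi x) -> psi x <= 0) ->
  forall x, x \in A -> psi x <= 0.
Proof.
move=> H x xA; case: (@Order.TotalTheory.arg_maxP _ _ A [` xA]%fset xpredT
  (fun y => psi (val y))) => // z _ zmax.
have zm y : y \in A -> psi y <= psi (val z) by move=> yA; exact: (zmax [` yA]%fset).
by apply: le_trans (zm x xA) _; apply: H; [exact: fsvalP|exact: zm].
Qed.

Section Scheme.
Context {R : realType} {d : nat} {Omega : set 'rV[R]_d} {M : {fset box R d}}.
Hypothesis hM : mac_grid Omega M.
Context {gamma eps eta dt : R}.
Hypotheses (hgamma : 1 < gamma) (heps : 0 < eps) (heta : 0 < eta) (hdt : 0 < dt).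
Context {C : R} {rt : box R d -> R}.
Hypothesis rt0 : forall K, K \in M -> 0 < rt K.
Implicit Types (K L s : box R d) (i j : 'I_d) (b : bool) (rho u : box R d -> R).

Local Notation h' := (derive1 (h_gamma gamma)).
Local Notation pot := (fun K => C - h' (rt K)).

(** The departure psi from hydrostatic equilibrium: since the potential is
    C - h'(rt), it is the total potential h'(rho) + phi up to the constant C. *)
Definition drive rho K : R := h' (rho K) - h' (rt K).

Lemma drive_eq0 rho K : rho K = rt K -> drive rho K = 0.
Proof. by move=> rE; rewrite /drive rE subrr. Qed.

Lemma drive_le0 rho K : 0 < rho K -> K \in M ->
  (drive rho K <= 0) = (rho K <= rt K).
Proof.
by move=> r0 KM; rewrite /drive subr_le0 derive1_h_gamma_le// rt0.
Qed.

Lemma drive_ge0 rho K : 0 < rho K -> K \in M ->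
  (0 <= drive rho K) = (rt K <= rho K).
Proof.
by move=> r0 KM; rewrite /drive subr_ge0 derive1_h_gamma_le// rt0.
Qed.

(** The defining equation of the interface density turns the pressure gradient
    into rho_s times the gradient of h'(rho), which combines with the gradient
    of the potential. *)
Lemma balance_drive rho i s :
  (forall K, K \in M -> 0 < rho K) -> s \in int_faces Omega M i ->
  balance M gamma pot rho i s =
  area i s / vol (dual M i s) * rho_face M gamma rho i s *
  (drive rho (adj M i s true) - drive rho (adj M i s false)).
Proof.
move=> r0 /(int_face_cells hM)[KM LM _ _].
have [_] := rho_interfaceP hgamma (r0 _ KM) (r0 _ LM).
have alg (g r pK pL hK hL tK tL : R) : pK - pL = r * (hK - hL) ->
    g * (pL - pK) + r * (g * ((C - tL) - (C - tK))) =
    g * r * ((hL - tL) - (hK - tK)).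
  by move=> e; rewrite -(opprB pK) e; ring.
exact: alg.
Qed.

(** When the transporting velocity vanishes, the stabilisation alone produces
    the mass flux, which is then a discrete diffusion of psi. *)
Lemma flux_drive rho u K i b :
  (forall K, K \in M -> 0 < rho K) ->
  (forall i s, s \in int_faces Omega M i -> u s = 0) -> K \in M ->
  exists k L, [/\ 0 <= k, L \in M &
    flux Omega M gamma eps eta dt pot rho u K i b =
    k * (drive rho K - drive rho L)].
Proof.
move=> r0 u0 KM; rewrite /flux; case: ifPn => si; last first.
  by exists 0, K; rewrite lexx mul0r.
have [KM' LM' _ _] := int_face_cells hM si.
rewrite /delta_u si (u0 i)// sub0r balance_drive//.
have ar := area_gt0 hM si; have vd := vol_dual_gt0 hM si.
move: (adj_facet hM i b KM) KM' LM' ar vd.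
set s := facet K i b => adjK KM' LM' ar vd.
pose k := area i s * rho_face M gamma rho i s * (eta * dt / eps ^+ 2 *
  (area i s / vol (dual M i s) * rho_face M gamma rho i s)).
have k0 : 0 <= k.
  have [rf _] := rho_interfaceP hgamma (r0 _ KM') (r0 _ LM').
  by rewrite /k ltW// !(mulr_gt0, invr_gt0) ?exprn_gt0.
exists k, (adj M i s b); split=> //; first by case: (b).
have up (w r c g x y : R) :
    w * r * - (c * (g * r * (y - x))) * 1 = w * r * (c * (g * r)) * (x - y).
  by ring.
have down (w r c g x y : R) :
    w * r * - (c * (g * r * (x - y))) * -1 = w * r * (c * (g * r)) * (x - y).
  by ring.
by rewrite /k /nu; case: (b) adjK => /= ->; [exact: up|exact: down].
Qed.

Lemma no_drive_flux0 rho u K i b :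
  (forall K, K \in M -> rho K = rt K) ->
  (forall i s, s \in int_faces Omega M i -> u s = 0) -> K \in M ->
  flux Omega M gamma eps eta dt pot rho u K i b = 0.
Proof.
move=> rE u0 KM.
have r0 L : L \in M -> 0 < rho L by move=> LM; rewrite rE// rt0.
have [k [L [_ LM ->]]] := flux_drive i b r0 u0 KM.
by rewrite !drive_eq0 ?rE// subrr mulr0.
Qed.

Lemma no_drive_dual_flux0 rho u i s j b :
  (forall K, K \in M -> rho K = rt K) ->
  (forall i s, s \in int_faces Omega M i -> u s = 0) ->
  s \in int_faces Omega M i ->
  dual_flux Omega M gamma eps eta dt pot rho u i s j b = 0.
Proof.
move=> rE u0 si; have [KM LM _ _] := int_face_cells hM si.
have sM b' : adj M i s b' \in M by case: b'.
rewrite /dual_flux; case: ifP => // _.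
by case: ifP => _; rewrite !no_drive_flux0// ?subrr ?addr0 mul0r.
Qed.

(** A maximum principle in place of an energy estimate: testing at the extremal
    cells of psi avoids any summation by parts over the grid. *)
Lemma mass_eq_equilibrium rho u rho' :
  (forall K, K \in M -> rho K = rt K) ->
  (forall i s, s \in int_faces Omega M i -> u s = 0) ->
  (forall K, K \in M -> 0 < rho' K) ->
  mass_eq Omega M gamma eps eta dt pot rho u rho' ->
  forall K, K \in M -> rho' K = rt K.
Proof.
move=> rE u0 r0 mass.
have massE K : K \in M -> rho' K - rt K =
    - (dt / vol K * \sum_(i < d) \sum_(b : bool)
        flux Omega M gamma eps eta dt pot rho' u K i b).
  move=> KM; have := mass K KM; rewrite rE//.
  move/eqP; rewrite addr_eq0 => /eqP E.
  by rewrite -[LHS](divfK (lt0r_neq0 hdt)) E; ring.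
have w0 K : K \in M -> 0 <= dt / vol K.
  by move=> KM; rewrite divr_ge0 ?ltW// (vol_cell_gt0 hM).
have le0 : forall K, K \in M -> drive rho' K <= 0.
  apply: max_principle => K KM Kmax.
  rewrite drive_le0 ?r0// -subr_le0 massE// oppr_le0.
  rewrite mulr_ge0 ?w0// sumr_ge0// => i _; rewrite sumr_ge0// => b _.
  have [k [L [k0 LM ->]]] := flux_drive i b r0 u0 KM.
  by rewrite mulr_ge0// subr_ge0 Kmax.
have ge0 : forall K, K \in M -> - drive rho' K <= 0.
  apply: max_principle => K KM Kmin.
  rewrite oppr_le0 drive_ge0 ?r0// -subr_ge0 massE//.
  rewrite -mulrN mulr_ge0 ?w0// -sumrN sumr_ge0// => i _.
  rewrite -sumrN sumr_ge0// => b _.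
  have [k [L [k0 LM ->]]] := flux_drive i b r0 u0 KM.
  by rewrite -mulrN mulr_ge0// opprB subr_ge0 -lerN2 Kmin.
move=> K KM; apply/eqP; rewrite eq_le.
rewrite -(drive_le0 (r0 _ KM) KM) -(drive_ge0 (r0 _ KM) KM).
by rewrite le0//= -oppr_le0 ge0.
Qed.

(** Once rho' = rt, the fluxes and the balance in the momentum equation vanish,
    and what remains is the time derivative of the dual mean times u'. *)
Lemma scheme_step_equilibrium rho u rho' u' :
  (forall K, K \in M -> rho K = rt K) ->
  (forall i s, s \in faces M i -> u s = 0) ->
  scheme_step Omega M gamma eps eta dt pot rho u rho' u' ->
  (forall K, K \in M -> rho' K = rt K) /\
  (forall i s, s \in faces M i -> u' s = 0).
Proof.
move=> rE uf [r0 u'ext mass mom].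
have u0 i s : s \in int_faces Omega M i -> u s = 0.
  by move=> /int_faces_sub; exact: uf.
have r'E := mass_eq_equilibrium rE u0 r0 mass; split=> // i s sf.
have [si|] := boolP (s \in int_faces Omega M i); last exact: u'ext.
have := mom i s si; rewrite (u0 i)// mulr0 subr0.
rewrite big1 ?mulr0 ?addr0; last first.
  by move=> j _; rewrite big1// => b _; rewrite no_drive_dual_flux0// mul0r.
have : balance M gamma pot rho' i s = 0.
  have [KM LM _ _] := int_face_cells hM si.
  by rewrite balance_drive// !drive_eq0 ?r'E// subrr mulr0.
rewrite /balance => /eqP; rewrite addr_eq0 => /eqP ->.
rewrite mulrN mulNr => /eqP; rewrite -subr_eq0 addrK mulf_eq0 invr_eq0.
rewrite (gt_eqF hdt) orbF mulf_eq0 gt_eqF ?(dual_mean_gt0 hM)//.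
by move=> /eqP.
Qed.

Lemma equilibrium_scheme_step :
  scheme_step Omega M gamma eps eta dt pot rt (fun=> 0) rt (fun=> 0).
Proof.
split=> // [K KM|i s si].
  rewrite subrr mul0r add0r big1 ?mulr0// => i _; rewrite big1// => b _.
  by rewrite no_drive_flux0.
rewrite !mulr0 subrr mul0r add0r big1 ?mulr0 ?add0r; last first.
  by move=> j _; rewrite big1// => b _; rewrite no_drive_dual_flux0// mul0r.
have : balance M gamma pot rt i s = 0.
  by rewrite balance_drive// !drive_eq0// subrr mulr0.
rewrite /balance => /eqP; rewrite addr_eq0 => /eqP ->.
by rewrite mulrN mulNr.
Qed.

Lemma relative_energy_eq0 rho u :
  (forall K, K \in M -> 0 < rho K) -> H_E0 Omega M u ->
  relative_energy Omega M gamma eps rt rho u = 0 <->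
  (forall K, K \in M -> rho K = rt K) /\
  (forall i s, s \in faces M i -> u s = 0).
Proof.
move=> r0 uext; rewrite /relative_energy; split; last first.
  move=> [rE uf]; rewrite big_seq big1 ?mulr0 ?add0r; last first.
    by move=> K KM; rewrite rE// Pi_gammaxx mulr0.
  rewrite big1// => i _; rewrite big_seq big1// => s /int_faces_sub sf.
  by rewrite (uf i)// expr0n !mulr0.
have P0 K : K \in M -> 0 <= vol K * Pi_gamma gamma (rho K) (rt K).
  by move=> KM; rewrite mulr_ge0 ?(ltW (vol_cell_gt0 hM KM))// Pi_gamma_ge0 ?r0 ?rt0.
have k0 i s : s \in int_faces Omega M i ->
    0 <= vol (dual M i s) * (2^-1 * dual_mean M rho i s * u s ^+ 2).
  move=> si; have vd := vol_dual_gt0 hM si; have dm := dual_mean_gt0 hM r0 si.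
  by rewrite (mulr_ge0 (ltW vd))// mulr_ge0 ?sqr_ge0// mulr_ge0// ltW.
have S1 : 0 <= \sum_(K <- M) vol K * Pi_gamma gamma (rho K) (rt K).
  by rewrite big_seq sumr_ge0.
have S2 i : 0 <= \sum_(s <- int_faces Omega M i)
    vol (dual M i s) * (2^-1 * dual_mean M rho i s * u s ^+ 2).
  by rewrite big_seq sumr_ge0// => s; exact: k0.
have e0 : 0 < (eps ^+ 2)^-1 by rewrite invr_gt0 exprn_gt0.
move/eqP; rewrite paddr_eq0; last 2 first.
- by rewrite mulr_ge0// ltW.
- by rewrite sumr_ge0.
rewrite mulf_eq0 (gt_eqF e0)/= => /andP[+ /eqP Z2]; split=> [K KM|i s sf].
- have Z1 : \sum_(K <- M) vol K * Pi_gamma gamma (rho K) (rt K) = 0.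
    by apply/eqP.
  apply/eqP; apply/negPn/negP => neq.
  have : 0 < vol K * Pi_gamma gamma (rho K) (rt K).
    by rewrite mulr_gt0 ?(vol_cell_gt0 hM)// Pi_gamma_gt0 ?r0 ?rt0.
  suff -> : vol K * Pi_gamma gamma (rho K) (rt K) = 0 by rewrite ltxx.
  move/eqP : Z1; rewrite big_seq psumr_eq0// => /allP/(_ K KM).
  by rewrite KM => /eqP.
- have [si|] := boolP (s \in int_faces Omega M i); last exact: uext.
  have /eqP : \sum_(s <- int_faces Omega M i)
      vol (dual M i s) * (2^-1 * dual_mean M rho i s * u s ^+ 2) = 0.
    by apply: (psumr_eq0P _ Z2).
  rewrite big_seq psumr_eq0; last by move=> s'; exact: k0.
  move=> /allP/(_ s si); rewrite si /= mulf_eq0 (gt_eqF (vol_dual_gt0 hM si)).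
  rewrite mulf_eq0 mulf_eq0 (gt_eqF (dual_mean_gt0 hM r0 si)) invr_eq0.
  by rewrite pnatr_eq0 sqrf_eq0 => /eqP.
Qed.

End Scheme.

(** * Hydrostatic equilibrium as the unique solution *)

Unset Implicit Arguments.
Set Strict Implicit.

Theorem theorem5p7 (R : realType) (d : nat) (hd : (1 <= d <= 3)%N)
    (Omega : set 'rV[R]_d) (hOmega : domain Omega)
    (M : {fset box R d}) (hM : mac_grid Omega M)
    (T dt gamma eps eta : R) (hT : 0 < T) (hdt : 0 < dt) (hgamma : 1 < gamma)
    (heps : 0 < eps <= 1) (heta : 0 < eta)
    (phi : 'rV[R]_d -> R) (hphi : smooth_on_closure Omega phi)
    (m0 C : R) (hC : hydrostatic_constant gamma Omega phi m0 C) :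
  let rho_t := rho_tilde gamma phi C in
  let phi_d := phi_cell gamma phi C in
  (forall rho u rho' u' : box R d -> R,
    (forall K, K \in M -> 0 < rho K) -> H_E0 Omega M u ->
    scheme_step Omega M gamma eps eta dt phi_d rho u rho' u' ->
    ((forall K, K \in M -> rho' K = rho_t K) /\
     (forall (i : 'I_d) s, s \in faces M i -> u' s = 0)) <->
    relative_energy Omega M gamma eps rho_t rho' u' = 0)
  /\
  (let solution := scheme_solution Omega M gamma eps eta dt phi_d
                     (Num.truncn (T / dt)) rho_t (fun=> 0) in
   solution (fun _ => rho_t) (fun _ _ => 0) /\
   forall rho u : nat -> box R d -> R, solution rho u ->
     forall n, (n <= Num.truncn (T / dt))%N ->
       (forall K, K \in M -> rho n K = rho_t K) /\
       (forall (i : 'I_d) s, s \in faces M i -> u n s = 0)).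
Proof.
move=> rho_t phi_d; have [eps0 _] := andP heps.
have rt0 K : K \in M -> 0 < rho_t K by exact: (rho_tilde_gt0 hd hM hgamma hphi hC).
split=> [rho u rho' u' _ _ [r0 u0 _ _]|solution].
  by apply: iff_sym; exact: (relative_energy_eq0 hM hgamma eps0 rt0).
split=> [|rho u [rho0 u0 step]].
  by split=> // n _; exact: (equilibrium_scheme_step hM hgamma eps0 heta hdt rt0).
elim=> [|n IH] nN; first by split.
have [rE uE] := IH (ltnW nN).
exact: (scheme_step_equilibrium hM hgamma eps0 heta hdt rt0 rE uE (step n nN)).
Qed.
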